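(* For any $r>0$ there exists $C_r>0$ depending only on $r$ such that for any two sequences of complex numbers $\{\lambda_k\}_{k\ge1}$, $\{\tilde\lambda_k\}_{k\ge1}$ of the form $\lambda_k=(k+\varkappa_k)^2$, $\tilde\lambda_k=(k+\tilde\varkappa_k)^2$ with $\{\varkappa_k\},\{\tilde\varkappa_k\}\in l_2$, with associated functions $w,\tilde w\in L_2(0,\pi)$ (defined in the context), the estimates $$\|w-\tilde w\|_{L_2(0,\pi)}\le C_r\,\Lambda(\{\lambda_n\},\{\tilde\lambda_n\}),\qquad \|w-\tilde w\|_{L_\infty(0,\pi)}\le C_r\,\Lambda_1(\{\lambda_n\},\{\tilde\lambda_n\})$$ hold as soon as $\Lambda(\{\lambda_n\},\{n^2\})\le r$ and $\Lambda(\{\tilde\lambda_n\},\{n^2\})\le r$. Moreover, $\Lambda_1(\{\lambda_n\},\{\tilde\lambda_n\})<\infty$ implies $w-\tilde w\in C[0,\pi]$ (up to equality almost everywhere).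
   Context: For a complex sequence $\{\lambda_k\}_{k\ge1}$ with $\lambda_k=(k+\varkappa_k)^2$, $\{\varkappa_k\}\in l_2$, put $$\Delta(\lambda)=\pi\prod_{k=1}^\infty\frac{\lambda_k-\lambda}{k^2},\qquad w(x)=\frac2\pi\sum_{k=1}^\infty k\,\Delta(k^2)\sin kx .$$ It is known that $w\in L_2(0,\pi)$ (the series converging in $L_2(0,\pi)$) and that $$\Delta(\lambda)=\frac{\sin\rho\pi}{\rho}+\int_0^\pi w(x)\frac{\sin\rho x}{\rho}\,dx,\qquad \rho^2=\lambda.$$ The functions $\tilde\Delta,\tilde w$ are constructed from $\{\tilde\lambda_k\}$ in the same way. $$\Lambda(\{\lambda_n\},\{\tilde\lambda_n\}):=\sqrt{\sum_{k=1}^\infty\frac{|\lambda_k-\tilde\lambda_k|^2}{k^2}},\qquad \Lambda_1(\{\lambda_n\},\{\tilde\lambda_n\}):=\sum_{k=1}^\infty\frac{|\lambda_k-\tilde\lambda_k|}{k}.$$ The value $\Lambda_1$ may be $+\infty$; an inequality with a possibly infinite right-hand side means that if the right-hand side is finite, then so is the left-hand side and the inequality holds. *)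

(* Defs.v *)
From HB Require Import structures.
From mathcomp Require Import all_boot all_order all_algebra.
From mathcomp Require Import all_classical all_reals all_analysis.
From mathcomp Require Import complex.

Set Implicit Arguments.
Unset Strict Implicit.
Unset Printing Implicit Defensive.

Import Order.TTheory GRing.Theory Num.Theory.
Import numFieldNormedType.Exports.

Local Open Scope classical_set_scope.
Local Open Scope ring_scope.
Local Open Scope complex_scope.

(* The complex numbers are R[i], over an arbitrary realType R.
   Normc.normc is the real-valued modulus (`|z| itself lives in R[i]), and the
   topology of C is the norm topology of R[i]^o.
   All sequences indexed by k >= 1 are functions on nat whose value at 0 is
   never used. *)

Definition l2 (R : realType) (kappa : nat -> R[i]) : Prop :=
  (\sum_(1 <= k <oo) (Normc.normc (kappa k) ^+ 2)%:E < +oo)%E.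

Definition l2_perturbed_squares (R : realType) (lam : nat -> R[i]) : Prop :=
  exists2 kappa : nat -> R[i], l2 kappa &
    forall k : nat, (0 < k)%N -> lam k = (k%:R + kappa k) ^+ 2.

Definition Delta (R : realType) (lam : nat -> R[i]) (z : R[i]) : R[i] :=
  pi%:C * limn (fun n => \prod_(1 <= k < n.+1)
    ((lam k - z) / k%:R ^+ 2) : R[i]^o).

Definition w_partial (R : realType) (lam : nat -> R[i]) (n : nat) (x : R) :
    R[i] :=
  (2 / pi)%:C * \sum_(1 <= k < n.+1)
    k%:R * Delta lam (k%:R ^+ 2) * (sin (k%:R * x))%:C.

(* Norm of L_p(0, pi) for complex-valued functions defined on all of R, whose
   values outside (0, pi) are irrelevant: \_ D extends by 0 outside D. *)
Definition Lnorm0pi (R : realType) (p : \bar R) (f : R -> R[i]) : \bar R :=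
  ('N[@lebesgue_measure R]_p
    [(fun x => (Normc.normc (f x))%:E) \_ `]0%R, (pi : R)[])%E.

Definition inL2 (R : realType) (f : R -> R[i]) : Prop :=
  [/\ measurable_fun `]0%R, (pi : R)[ (fun x => complex.Re (f x)),
      measurable_fun `]0%R, (pi : R)[ (fun x => complex.Im (f x)) &
      (Lnorm0pi 2%:E f < +oo)%E].

(* w is (a representative of) the sum of its sine series in L_2(0, pi); being
   an L_2-limit, this determines w up to equality a.e. on (0, pi). *)
Definition associated_w (R : realType) (lam : nat -> R[i]) (w : R -> R[i]) :
    Prop :=
  inL2 w /\
  ((fun n => Lnorm0pi 2%:E (fun x => w x - w_partial lam n x)) @ \oo --> 0%E).

Definition Lambda (R : realType) (lam lamt : nat -> R[i]) : \bar R :=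
  sqrte (\sum_(1 <= k <oo)
    (Normc.normc (lam k - lamt k) ^+ 2 / k%:R ^+ 2)%:E)%E.

Definition Lambda1 (R : realType) (lam lamt : nat -> R[i]) : \bar R :=
  (\sum_(1 <= k <oo) (Normc.normc (lam k - lamt k) / k%:R)%:E)%E.

(* f belongs to C[0, pi] up to equality almost everywhere. *)
Definition ae_continuous0pi (R : realType) (f : R -> R[i]) : Prop :=
  exists g : R -> R[i]^o,
    {within `[0%R, (pi : R)], continuous g} /\
    {ae @lebesgue_measure R, forall x, x \in `]0%R, (pi : R)[ -> f x = g x}.

(* Main.v *)
Require Import Defs.
From mathcomp Require Import all_boot all_order all_algebra.
From mathcomp Require Import all_classical all_reals all_analysis.
From mathcomp Require Import complex measurable_realfun ring lra zify.

(* At [lambda = n^2] the product defining [Delta] reads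
   [n Delta(n^2) = (-1)^(n-1) (pi / 2) b_n P_n], where
   [b_k = (lambda_k - k^2) / k] and
   [P_n = prod_(k <> n) (1 + k b_k / (k^2 - n^2))].  Since
   [k / |k^2 - n^2| <= 1 / |k - n|] is square summable in [k] uniformly in [n],
   and symmetrically in [n] uniformly in [k], Cauchy-Schwarz bounds [P_n] and
   its variation, and both the l_1 and the l_2 distance of the sine
   coefficients of [w] and [w~] are controlled by the same distance of [b] and
   [b~].  The L_2 estimate is then Bessel's inequality, and the uniform one
   holds because the sine series of [w - w~] converges absolutely. *)

Set Implicit Arguments.
Unset Strict Implicit.
Unset Printing Implicit Defensive.

Import Order.TTheory GRing.Theory Num.Theory.
Import numFieldNormedType.Exports.

Local Open Scope classical_set_scope.
Local Open Scope ring_scope.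
Local Open Scope complex_scope.

(** Every estimate is proved for the truncated products [pprod b n N] and for finite sums over [n],
    with constants that depend neither on the truncation [N] nor on the number [M] of terms; then
    [N] tends to infinity with [M] fixed, so only limits of finite sums occur. No smallness of [b]
    is available: products are compared through [|1 + z| <= exp |z|], hence the [expR (2 * r)] in
    the constants. The difference [b_n P_n - b~_n P~_n] is split as
    [(b_n - b~_n) P_n + b~_n (P_n - P~_n)]. The second part leads to a double sum of
    [|b~_n| |b_k - b~_k| / |k - n|], whose kernel is not summable in either index; the missing decay
    comes from [|b~_n|]. For the l_1 bound Cauchy-Schwarz is applied in [n] at fixed [k]; for the
    l_2 bound it is applied in [k] at fixed [n], and the factor [|b~_n|^2] makes the result summable
    in [n]. As [w] and [w~] are only L_2 limits, they are reached through squared integrals of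
    partial sums. *)

Section ComplexModulus.
Variable R : realType.
Implicit Types x y z : R[i].
Local Notation nc := (@Normc.normc R).

(** * Modulus and convergence in [R[i]] *)

Lemma normr_normc z : `|z| = (nc z)%:C.
Proof. by []. Qed.

Lemma normc_ge0 z : 0 <= nc z.
Proof. by case: z => a b; exact: sqrtr_ge0. Qed.

Lemma normcD x y : nc (x + y) <= nc x + nc y.
Proof. exact: (@le_normcD R). Qed.

Lemma normc_opp x : nc (- x) = nc x.
Proof. exact: (@normcN R). Qed.

Lemma normc_distC x y : nc (x - y) = nc (y - x).
Proof. by rewrite -normc_opp opprB. Qed.

Lemma normc_real (a : R) : nc a%:C = `|a|.
Proof. by rewrite /Normc.normc/= expr0n/= addr0 sqrtr_sqr. Qed.

Lemma normc_nat n : nc n%:R = n%:R.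
Proof. by rewrite -(rmorph_nat (real_complex R)) normc_real ger0_norm. Qed.

Lemma normc_sum (I : Type) (s : seq I) (P : pred I) (f : I -> R[i]) :
  nc (\sum_(i <- s | P i) f i) <= \sum_(i <- s | P i) nc (f i).
Proof.
elim/big_rec2: _ => [|i y x _ h]; first by rewrite Normc.normc0.
exact: le_trans (normcD _ _) (lerD _ _).
Qed.

Lemma normcX2 z : nc z ^+ 2 = complex.Re z ^+ 2 + complex.Im z ^+ 2.
Proof. by case: z => a b; rewrite sqr_sqrtr// addr_ge0 ?sqr_ge0. Qed.

Lemma normc_Re z : `|complex.Re z| <= nc z.
Proof.
rewrite -(@ler_pXn2r _ 2) ?nnegrE ?normc_ge0//.
by rewrite real_normK ?num_real// normcX2 lerDl sqr_ge0.
Qed.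

Lemma normc_Im z : `|complex.Im z| <= nc z.
Proof.
rewrite -(@ler_pXn2r _ 2) ?nnegrE ?normc_ge0//.
by rewrite real_normK ?num_real// normcX2 lerDr sqr_ge0.
Qed.

Lemma normc_le_ReIm z : nc z <= `|complex.Re z| + `|complex.Im z|.
Proof.
rewrite -(@ler_pXn2r _ 2) ?nnegrE ?normc_ge0 ?addr_ge0//.
rewrite normcX2 sqrrD !real_normK ?num_real//.
by rewrite lerD2r lerDl mulrn_wge0// mulr_ge0.
Qed.

Lemma ler_normc_dist x y : `|nc x - nc y| <= nc (x - y).
Proof.
have h u v : nc u - nc v <= nc (u - v).
  by rewrite lerBlDr; apply: le_trans (normcD _ _); rewrite subrK.
by rewrite ler_norml h andbT lerNl opprB normc_distC.
Qed.

Lemma cvg_normcP (T : Type) (F : set_system T) (FF : Filter F)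
    (f : T -> R[i]) (l : R[i]) :
  ((f : T -> R[i]^o) @ F --> (l : R[i]^o)) <->
  (forall e : R, 0 < e -> \forall t \near F, nc (l - f t) < e).
Proof.
split=> [/cvgrPdist_lt h e e0|h].
  have e0' : 0 < e%:C :> R[i] by rewrite ltcR.
  near=> t.
  have : `|(l : R[i]^o) - f t| < e%:C by near: t; exact: h.
  by rewrite [X in X < _]normr_normc ltcR.
(* In the order of [R[i]], [0 < a +i* b] forces [b = 0], so only real radii occur. *)
apply/cvgrPdist_lt => -[a b]; rewrite ltcE/= => /andP[/eqP -> a0].
near=> t; have : nc (l - f t) < a by near: t; exact: h.
by rewrite -ltcR.
Unshelve. all: by end_near. Qed.

Lemma cvg_ReIm (T : Type) (F : set_system T) (FF : Filter F)
    (f : T -> R[i]) (l : R[i]) :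
  (fun t => complex.Re (f t)) @ F --> complex.Re l ->
  (fun t => complex.Im (f t)) @ F --> complex.Im l ->
  (f : T -> R[i]^o) @ F --> (l : R[i]^o).
Proof.
move=> /cvgrPdist_lt fr /cvgrPdist_lt fi; apply/cvg_normcP => e e0.
have e2 : 0 < e / 2 by rewrite divr_gt0.
near=> t; apply: le_lt_trans (normc_le_ReIm _) _.
rewrite !raddfB/= (splitr e) ltrD//; near: t; [exact: fr|exact: fi].
Unshelve. all: by end_near. Qed.

Lemma cvg_normc (T : Type) (F : set_system T) (FF : Filter F)
    (f : T -> R[i]) (l : R[i]) :
  ((f : T -> R[i]^o) @ F --> (l : R[i]^o)) -> (nc \o f) @ F --> nc l.
Proof.
move=> /cvg_normcP h; apply/cvgrPdist_lt => e e0.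
near=> t; apply: le_lt_trans (ler_normc_dist _ _) _.
by near: t; exact: h.
Unshelve. all: by end_near. Qed.

(** The increments form an absolutely convergent series, and [u] is its telescoped sum plus
    [u 0]. *)
Lemma cvg_bounded_variation (u : R^nat) (M : R) :
  (forall n, \sum_(0 <= k < n) `|u k.+1 - u k| <= M) -> cvgn u.
Proof.
move=> h.
have c : cvgn (series (fun k => u k.+1 - u k)).
  apply: normed_cvg; apply: nondecreasing_is_cvgn.
    by move=> m n mn; exact: (@nondecreasing_series _ (fun k => `|u k.+1 - u k|)).
  by exists M => _ [n _ <-]; exact: h.
suff -> : u = (fun n => series (fun k => u k.+1 - u k) n + u 0).
  by apply: is_cvgD => //; exact: is_cvg_cst.
apply/funext => n; rewrite /series/= telescope_sumr// subrK//.
Qed.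

Lemma cvg_complex_bounded_variation (u : nat -> R[i]) (M : R) :
  (forall n, \sum_(0 <= k < n) nc (u k.+1 - u k) <= M) ->
  exists l : R[i], (u : nat -> R[i]^o) @ \oo --> (l : R[i]^o).
Proof.
move=> h.
have cr : cvgn (fun n => complex.Re (u n)).
  apply: (@cvg_bounded_variation _ M) => n; apply: le_trans (h n).
  apply: ler_sum => k _; apply: le_trans (normc_Re _).
  by rewrite raddfB.
have ci : cvgn (fun n => complex.Im (u n)).
  apply: (@cvg_bounded_variation _ M) => n; apply: le_trans (h n).
  apply: ler_sum => k _; apply: le_trans (normc_Im _).
  by rewrite raddfB.
exists (limn (fun n => complex.Re (u n)) +i* limn (fun n => complex.Im (u n))).
exact: cvg_ReIm.
Qed.

End ComplexModulus.

(** * Finite and infinite products of factors [1 + z] *)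

Section ProductEstimates.
Variable R : realType.
Local Notation nc := (@Normc.normc R).

Lemma normc_prod1D_le (I : Type) (s : seq I) (z : I -> R[i]) :
  nc (\prod_(i <- s) (1 + z i)) <= expR (\sum_(i <- s) nc (z i)).
Proof.
elim: s => [|i s IH]; first by rewrite !big_nil Normc.normc1 expR0.
rewrite !big_cons Normc.normcM expRD ler_pM ?normc_ge0//.
apply: le_trans (normcD _ _) _; rewrite Normc.normc1; exact: expR_ge1Dx.
Qed.

(** Peeling off one factor leaves [(z i - y i) * A + (1 + y i) * (A - B)], with [A] and [B] the
    remaining products: the first term is bounded by [normc_prod1D_le], the second by induction. *)
Lemma normc_prod1D_dist (I : Type) (s : seq I) (z y : I -> R[i]) :
  nc (\prod_(i <- s) (1 + z i) - \prod_(i <- s) (1 + y i)) <=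
  expR (\sum_(i <- s) nc (z i) + \sum_(i <- s) nc (y i)) *
  \sum_(i <- s) nc (z i - y i).
Proof.
elim: s => [|i s IH]; first by rewrite !big_nil subrr Normc.normc0 mulr0.
rewrite !big_cons.
set A := \prod_(j <- s) _; set B := \prod_(j <- s) _.
have := normc_prod1D_le s z; rewrite -/A.
move: IH; rewrite -/A -/B.
set Sz := \sum_(j <- s) _; set Sy := \sum_(j <- s) _.
set S := \sum_(j <- s) _ => IH hA.
have Sz0 : 0 <= Sz by apply: sumr_ge0 => *; exact: normc_ge0.
have Sy0 : 0 <= Sy by apply: sumr_ge0 => *; exact: normc_ge0.
have S0 : 0 <= S by apply: sumr_ge0 => *; exact: normc_ge0.
have -> : (1 + z i) * A - (1 + y i) * B = (z i - y i) * A + (1 + y i) * (A - B).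
  by ring.
apply: le_trans (normcD _ _) _; rewrite !Normc.normcM mulrDr lerD//.
  rewrite mulrC ler_wpM2r ?normc_ge0//; apply: le_trans hA _.
  by rewrite ler_expR -addrA addrCA lerDl !addr_ge0 ?normc_ge0.
apply: (@le_trans _ _ (expR (nc (y i)) * (expR (Sz + Sy) * S))).
  rewrite ler_pM ?normc_ge0//.
  apply: le_trans (normcD _ _) _; rewrite Normc.normc1; exact: expR_ge1Dx.
rewrite mulrA -expRD ler_wpM2r// ler_expR.
have := normc_ge0 (z i); lra.
Qed.

(** Each increment is the product so far times the new [z k], hence at most [expR M * nc (z k)]: the
    partial products have bounded variation. *)
Lemma cvg_prod1D (z : nat -> R[i]) (M : R) :
  (forall N, \sum_(1 <= k < N.+1) nc (z k) <= M) ->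
  exists l : R[i], ((fun N => \prod_(1 <= k < N.+1) (1 + z k)) : nat -> R[i]^o)
    @ \oo --> (l : R[i]^o).
Proof.
move=> h; apply: (@cvg_complex_bounded_variation _ _ (expR M * M)) => n.
apply: (@le_trans _ _ (expR M * \sum_(1 <= k < n.+1) nc (z k))); last first.
  by rewrite ler_wpM2l ?expR_ge0.
rewrite big_add1/= mulr_sumr ler_sum// => k _.
rewrite [X in nc (X - _)]big_nat_recr//= mulrDr mulr1 addrAC subrr add0r.
rewrite Normc.normcM ler_wpM2r ?normc_ge0//.
by apply: le_trans (normc_prod1D_le _ _) _; rewrite ler_expR.
Qed.

End ProductEstimates.

(** * Cauchy-Schwarz and the kernel [1 / (k - n)] *)

Section RealSums.
Variable R : realType.

Lemma cauchy_schwarz_sum (I : Type) (s : seq I) (x y : I -> R) :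
  (\sum_(i <- s) x i * y i) ^+ 2 <=
  (\sum_(i <- s) x i ^+ 2) * (\sum_(i <- s) y i ^+ 2).
Proof.
elim: s => [|i s IH]; first by rewrite !big_nil expr0n mul0r.
rewrite !big_cons.
have A0 : 0 <= \sum_(j <- s) x j ^+ 2 by apply: sumr_ge0 => *; exact: sqr_ge0.
have B0 : 0 <= \sum_(j <- s) y j ^+ 2 by apply: sumr_ge0 => *; exact: sqr_ge0.
move: IH A0 B0; set A := \sum_(j <- s) x j ^+ 2.
set B := \sum_(j <- s) y j ^+ 2; set S := \sum_(j <- s) _ => IH A0 B0.
(* Only the cross term of the expanded square needs a bound. By induction its square is at most
   [4 * A * B * x i ^+ 2 * y i ^+ 2], and [4 p q <= (p + q)^2]. *)
suff h : 2 * (S * x i * y i) <= A * y i ^+ 2 + B * x i ^+ 2 by nra.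
have T0 : 0 <= A * y i ^+ 2 + B * x i ^+ 2.
  by rewrite addr_ge0// mulr_ge0// sqr_ge0.
apply: le_trans (ler_norm _) _.
rewrite -(@ler_pXn2r _ 2) ?nnegrE// real_normK ?num_real//.
have {}IH : S ^+ 2 * (x i ^+ 2 * y i ^+ 2) <= A * B * (x i ^+ 2 * y i ^+ 2).
  by rewrite ler_wpM2r// mulr_ge0 ?sqr_ge0.
have := sqr_ge0 (A * y i ^+ 2 - B * x i ^+ 2).
nra.
Qed.

(* [1/j^2 <= 1/(j - 1/2) - 1/(j + 1/2)] for every nonzero integer [j], so the
   sum telescopes; the term [k = n] is [0] because [0^-1 = 0], while the
   telescoping difference there is [-4]. *)
Lemma sum_inv_sqr_le4 (n N : nat) :
  \sum_(0 <= k < N) ((k%:R - n%:R)^-1 : R) ^+ 2 <= 4.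
Proof.
(* The telescoped sum is [1 / (n + 1/2 - N) - 1 / (n + 1/2)]; its last term is dropped, and the
   added [4] offsets the [-4] met at [k = n]. *)
have h : \sum_(0 <= k < N) ((k%:R - n%:R)^-1 : R) ^+ 2 <=
    (n%:R + 2^-1 - N%:R)^-1 + (if (n < N)%N then 4 else 0).
  elim: N => [|N IH].
    by rewrite big_geq// ltn0 addr0 invr_ge0 subr0 addr_ge0.
  rewrite big_nat_recr//=.
  have step : ((N%:R - n%:R)^-1 : R) ^+ 2 + (n%:R + 2^-1 - N%:R)^-1 +
      (if (n < N)%N then 4 else 0) <=
      (n%:R + 2^-1 - N.+1%:R)^-1 + (if (n < N.+1)%N then 4 else 0).
    have [nN|nN|->] := ltngtP n N.
    - have -> : (n < N.+1)%N by exact: ltnW.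
      rewrite lerD2r -subr_ge0 -[N.+1%:R]natr1.
      have h1 : 1 <= N%:R - n%:R :> R by rewrite lerBrDr addrC natr1 ler_nat.
      set j : R := N%:R - n%:R in h1 *.
      have -> : n%:R + 2^-1 - (N%:R + 1) = - (j + 2^-1) :> R by rewrite /j; field.
      have -> : n%:R + 2^-1 - N%:R = - (j - 2^-1) :> R by rewrite /j; ring.
      have -> : (- (j + 2^-1))^-1 - (j^-1 ^+ 2 + (- (j - 2^-1))^-1) =
          (4 * (j - 2^-1) * (j + 2^-1) * j ^+ 2)^-1.
        by field; apply/and3P; split; apply/eqP; lra.
      by rewrite invr_ge0; apply: mulr_ge0; [nra|exact: sqr_ge0].
    - rewrite ltnS leqNgt nN/= !addr0 -subr_ge0 -[N.+1%:R]natr1.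
      have h1 : 1 <= n%:R - N%:R :> R by rewrite lerBrDr addrC natr1 ler_nat.
      set j : R := n%:R - N%:R in h1 *.
      have -> : n%:R + 2^-1 - (N%:R + 1) = j - 2^-1 :> R by rewrite /j; field.
      have -> : n%:R + 2^-1 - N%:R = j + 2^-1 :> R by rewrite /j; ring.
      have -> : N%:R - n%:R = - j by rewrite /j opprB.
      have -> : (j - 2^-1)^-1 - ((- j)^-1 ^+ 2 + (j + 2^-1)^-1) =
          (4 * (j - 2^-1) * (j + 2^-1) * j ^+ 2)^-1.
        by field; apply/and3P; split; apply/eqP; lra.
      by rewrite invr_ge0; apply: mulr_ge0; [nra|exact: sqr_ge0].
    - rewrite ltnSn subrr invr0 expr0n/= add0r addr0 -[N.+1%:R]natr1.
      have -> : N%:R + 2^-1 - N%:R = 2^-1 :> R by ring.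
      have -> : N%:R + 2^-1 - (N%:R + 1) = - 2^-1 :> R by field.
      rewrite invrN !invrK; lra.
  by apply: le_trans step; rewrite addrC -addrA lerD2l.
apply: le_trans h _; case: ltnP => nN.
  rewrite -[leRHS]add0r lerD2r invr_le0.
  have : 1 <= N%:R - n%:R :> R by rewrite lerBrDr addrC natr1 ler_nat.
  lra.
rewrite addr0.
have h1 : 2^-1 <= n%:R + 2^-1 - N%:R :> R.
  have : 0 <= n%:R - N%:R :> R by rewrite subr_ge0 ler_nat.
  lra.
have : (n%:R + 2^-1 - N%:R)^-1 <= (2^-1)^-1 :> R.
  by rewrite lef_pV2// posrE; lra.
rewrite invrK; lra.
Qed.

Lemma sum_hilbert_le (x : nat -> R) (n N : nat) :
  (\sum_(1 <= k < N.+1) x k * `|(k%:R - n%:R)^-1|) ^+ 2 <=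
  4 * \sum_(1 <= k < N.+1) x k ^+ 2.
Proof.
apply: le_trans (cauchy_schwarz_sum _ _ _) _.
rewrite mulrC ler_wpM2r ?sumr_ge0// => [*|]; first exact: sqr_ge0.
apply: le_trans (sum_inv_sqr_le4 n N.+1).
under eq_bigr do rewrite real_normK ?num_real//.
by rewrite big_add1 [leRHS]big_nat_recl//= lerDr sqr_ge0.
Qed.

End RealSums.

(** * Truncated coefficients and their l_1 and l_2 distances *)

Section CoefficientEstimates.
Variable R : realType.
Local Notation nc := (@Normc.normc R).
Implicit Types b bt : nat -> R[i].

(* With [b k = (lam k - k^2) / k], the factor of [Delta lam (n^2)] of index
   [k <> n], divided by its unperturbed value [(k^2 - n^2) / k^2], is
   [1 + relfactor b n k]; at [k = n] the division by [0] makes [relfactor] vanish. *)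
Definition relfactor b (n k : nat) : R[i] :=
  k%:R * b k / (k%:R ^+ 2 - n%:R ^+ 2).

Definition pprod b (n N : nat) : R[i] :=
  \prod_(1 <= k < N.+1) (1 + relfactor b n k).

(** No case distinction is made at [k = n]: both sides vanish there because [0^-1 = 0]. *)
Lemma normc_relfactor_le b n k : (0 < k)%N ->
  nc (relfactor b n k) <= nc (b k) * `|(k%:R - n%:R)^-1|.
Proof.
move=> k0; rewrite /relfactor !Normc.normcM Normc.normcV normc_nat.
have -> : k%:R ^+ 2 - n%:R ^+ 2 = ((k%:R - n%:R) * (k%:R + n%:R))%:C :> R[i].
  by rewrite -subr_sqr rmorphB !rmorphXn !rmorph_nat.
rewrite normc_real normrM invfM normfV.
rewrite [k%:R * _]mulrC -mulrA ler_wpM2l ?normc_ge0//.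
rewrite mulrCA -[leRHS]mulr1 ler_wpM2l ?invr_ge0//.
rewrite ger0_norm ?addr_ge0// ler_pdivrMr ?mul1r ?lerDl//.
by rewrite ltr_wpDr// ltr0n.
Qed.

Lemma relfactorB b bt n k :
  relfactor b n k - relfactor bt n k = relfactor (fun k => b k - bt k) n k.
Proof. by rewrite /relfactor mulrBr mulrBl. Qed.

(** The bound is the square root of [4 * r ^+ 2] from [sum_hilbert_le], hence uniform in [n]. *)
Lemma sum_relfactor_le b (r : R) : 0 <= r ->
  (forall N, \sum_(1 <= k < N.+1) nc (b k) ^+ 2 <= r ^+ 2) ->
  forall n N, \sum_(1 <= k < N.+1) nc (relfactor b n k) <= 2 * r.
Proof.
move=> r0 hb n N.
apply: (@le_trans _ _ (\sum_(1 <= k < N.+1) nc (b k) * `|(k%:R - n%:R)^-1|)).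
  rewrite !big_nat ler_sum// => k /andP[k0 _]; exact: normc_relfactor_le.
rewrite -(@ler_pXn2r _ 2) ?nnegrE ?mulr_ge0//; last first.
  by apply: sumr_ge0 => k _; rewrite mulr_ge0 ?normc_ge0.
apply: le_trans (sum_hilbert_le _ _ _) _.
by rewrite exprMn -natrX ler_wpM2l.
Qed.

Lemma cvg_pprod b (r : R) : 0 <= r ->
  (forall N, \sum_(1 <= k < N.+1) nc (b k) ^+ 2 <= r ^+ 2) ->
  forall n, exists l : R[i],
    (pprod b n : nat -> R[i]^o) @ \oo --> (l : R[i]^o).
Proof. by move=> r0 /(sum_relfactor_le r0) h n; apply: cvg_prod1D (h n). Qed.

Variables (b bt : nat -> R[i]) (r : R).
Hypothesis r0 : 0 <= r.
Hypothesis hb : forall N, \sum_(1 <= k < N.+1) nc (b k) ^+ 2 <= r ^+ 2.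
Hypothesis hbt : forall N, \sum_(1 <= k < N.+1) nc (bt k) ^+ 2 <= r ^+ 2.

(** Bounds the modulus of every [pprod b n N] and [pprod bt n N]; the Lipschitz constant of these
    products is [E ^+ 2]. *)
Let E := expR (2 * r).
Let d k := nc (b k - bt k).
Let S n N := \sum_(1 <= k < N.+1) d k * `|(k%:R - n%:R : R)^-1|.
Let D n N := nc (b n * pprod b n N - bt n * pprod bt n N).

Let E0 : 0 <= E. Proof. exact: expR_ge0. Qed.
Let d0 k : 0 <= d k. Proof. exact: normc_ge0. Qed.
Let S0 n N : 0 <= S n N.
Proof. by apply: sumr_ge0 => k _; rewrite mulr_ge0. Qed.

#[local] Hint Resolve E0 d0 S0 : core.

Let D_le n N : D n N <= E * d n + E ^+ 2 * (nc (bt n) * S n N).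
Proof.
have -> : D n N = nc ((b n - bt n) * pprod b n N +
    bt n * (pprod b n N - pprod bt n N)) by congr nc; ring.
apply: le_trans (normcD _ _) _; rewrite !Normc.normcM lerD//.
  rewrite mulrC ler_wpM2r ?normc_ge0//; apply: le_trans (normc_prod1D_le _ (relfactor b n)) _.
  by rewrite ler_expR sum_relfactor_le.
rewrite mulrCA ler_wpM2l ?normc_ge0//.
apply: le_trans (normc_prod1D_dist _ (relfactor b n) (relfactor bt n)) _.
apply: ler_pM => //.
- by apply: sumr_ge0 => *; exact: normc_ge0.
- by rewrite expr2 -expRD ler_expR lerD// sum_relfactor_le.
- rewrite /S !big_nat ler_sum// => k /andP[k0 _]; rewrite relfactorB.
  exact: normc_relfactor_le.
Qed.

Lemma sum_coef_dist_l1 (L : R) :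
  (forall N, \sum_(1 <= k < N.+1) d k <= L) ->
  forall M N, \sum_(1 <= n < M.+1) D n N <= (E + E ^+ 2 * (2 * r)) * L.
Proof.
move=> hL M N.
apply: le_trans; first by apply: ler_sum => n _; exact: D_le.
rewrite big_split/= -!mulr_sumr mulrDl lerD//; first by rewrite ler_wpM2l.
rewrite -mulrA ler_wpM2l ?sqr_ge0//.
under eq_bigr do rewrite /S mulr_sumr.
(* At fixed [k] the sum over [n] of [nc (bt n) / |k - n|] is at most [2 * r]; summing over [n] first
   leaves [2 * r] times the l_1 distance. *)
rewrite exchange_big/=.
apply: (@le_trans _ _ (\sum_(1 <= k < N.+1) 2 * r * d k)); last first.
  by rewrite -mulr_sumr ler_wpM2l// mulr_ge0.
apply: ler_sum => k _.
under eq_bigr do rewrite mulrCA.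
rewrite -mulr_sumr mulrC ler_wpM2r//.
rewrite -(@ler_pXn2r _ 2) ?nnegrE ?mulr_ge0//; last first.
  by apply: sumr_ge0 => n _; rewrite mulr_ge0 ?normc_ge0.
(* The modulus of the kernel is symmetric, so [sum_hilbert_le] applies with [n] as summation index
   and [k] as centre. *)
under eq_bigr do rewrite -normrN -invrN opprB.
apply: le_trans (sum_hilbert_le _ _ _) _.
by rewrite exprMn -natrX ler_wpM2l.
Qed.

(** Apply [(x + y)^2 <= 2 x^2 + 2 y^2] to [D_le], then [S n N ^+ 2 <= 4 * L]: this gives
    [8 = 2 * 4], and the remaining [nc (bt n) ^+ 2] sums to at most [r ^+ 2]. Here [L] bounds a
    squared distance. *)
Lemma sum_coef_dist_l2 (L : R) :
  (forall N, \sum_(1 <= k < N.+1) d k ^+ 2 <= L) ->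
  forall M N, \sum_(1 <= n < M.+1) D n N ^+ 2 <=
    (2 * E ^+ 2 + 8 * E ^+ 4 * r ^+ 2) * L.
Proof.
move=> hL M N.
have L0 : 0 <= L by apply: le_trans (hL 0); apply: sumr_ge0 => *; exact: sqr_ge0.
apply: (@le_trans _ _ (\sum_(1 <= n < M.+1)
    (2 * E ^+ 2 * d n ^+ 2 + 8 * E ^+ 4 * L * nc (bt n) ^+ 2))).
  apply: ler_sum => n _.
  have h : D n N ^+ 2 <= (E * d n + E ^+ 2 * (nc (bt n) * S n N)) ^+ 2.
    rewrite ler_pXn2r ?nnegrE ?normc_ge0//.
    by rewrite addr_ge0// !mulr_ge0// ?normc_ge0 ?exprn_ge0.
  apply: (le_trans h).
  have hS : S n N ^+ 2 <= 4 * L.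
    by apply: le_trans (sum_hilbert_le _ _ _) _; rewrite ler_wpM2l.
  have h2 : E ^+ 4 * nc (bt n) ^+ 2 * S n N ^+ 2 <=
      E ^+ 4 * nc (bt n) ^+ 2 * (4 * L).
    by rewrite ler_wpM2l// mulr_ge0 ?exprn_ge0 ?normc_ge0.
  have := sqr_ge0 (E * d n - E ^+ 2 * (nc (bt n) * S n N)).
  nra.
rewrite big_split/= -!mulr_sumr [leRHS]mulrDl lerD//.
  by rewrite ler_wpM2l// mulr_ge0 ?sqr_ge0.
by rewrite mulrAC ler_wpM2r// ler_wpM2l ?mulr_ge0 ?exprn_ge0.
Qed.

End CoefficientEstimates.

(** * The value of [Delta lam] at [n^2] *)

Section DeltaAtSquares.
Variable R : realType.
Local Notation nc := (@Normc.normc R).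

Let qfactor (n k : nat) : R :=
  if k == n then 1 else (k%:R ^+ 2 - n%:R ^+ 2) / k%:R ^+ 2.

Let natr_fact_neq0 n : (n`!)%:R != 0 :> R.
Proof. by rewrite pnatr_eq0 -lt0n fact_gt0. Qed.

(** Below index [n] the numerators [(k - n)(k + n)] collect into factorials, with one sign per
    factor. *)
Let qprod_lt n m : (m < n)%N ->
  \prod_(1 <= k < m.+1) qfactor n k =
  (-1) ^+ m * ((n + m)`!)%:R / (n%:R * ((n - m.+1)`!)%:R * (m`!)%:R ^+ 2).
Proof.
elim: m => [|m IH] mn.
  rewrite big_geq// expr0 mul1r addn0 fact0 expr1n mulr1 subn1.
  case: n mn => // n _; rewrite factS/= natrM divff// mulf_neq0//.
rewrite big_nat_recr//= IH; last exact: ltnW.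
rewrite /qfactor ltn_eqF// addnS !factS !natrM.
have -> : (n - m.+1)%N = (n - m.+2).+1 by rewrite -subSn.
rewrite factS natrM -subSn// subSS natrB; last exact: ltnW.
rewrite [(-1) ^+ m.+1]exprS -[(n + m).+1]addnS natrD.
have n0 : n%:R != 0 :> R by rewrite pnatr_eq0 -lt0n; apply: leq_trans mn.
have m0 : m.+1%:R != 0 :> R by rewrite pnatr_eq0.
have nm0 : n%:R - m.+1%:R != 0 :> R.
  by rewrite subr_eq0 eqr_nat gtn_eqF.
have := natr_fact_neq0 m; have := natr_fact_neq0 (n - m.+2) => f1 f2.
by field; rewrite ?nat1r n0 m0 nm0 f1 f2.
Qed.

(** Past [k = n] the factors are positive, so the sign is final; the [1/2] comes from writing
    [(2n - 1)!] through [(2n)!]. As the factorial ratio tends to [1], this gives the classical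
    [prod_(k <> n) (1 - n^2 / k^2) = (-1)^(n-1) / 2] without the product formula of the sine. *)
Let qprod_ge n m : (0 < n)%N ->
  \prod_(1 <= k < (m + n).+1) qfactor n k =
  (-1) ^+ n.-1 / 2 * (((m + n + n)`!)%:R * (m`!)%:R / ((m + n)`!)%:R ^+ 2).
Proof.
case: n => // n _; elim: m => [|m IH].
  rewrite add0n big_nat_recr//= qprod_lt// /qfactor eqxx mulr1 subnn.
  rewrite fact0 addnS (addSn n n) !factS -addnS !natrM.
  have -> : (n.+1 + n.+1)%:R = 2 * n.+1%:R :> R.
    by rewrite -natrM; congr _%:R; lia.
  have m0 : n.+1%:R != 0 :> R by rewrite pnatr_eq0.
  have f1 := natr_fact_neq0 n.
  by field; rewrite ?nat1r m0 f1.
rewrite addSn big_nat_recr//= IH /qfactor gtn_eqF//; last first.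
  by rewrite ltnS leq_addl.
rewrite !addSn !factS !natrM.
have -> : (m + n.+1).+1%:R ^+ 2 - n.+1%:R ^+ 2 =
    (m + n.+1 + n.+1).+1%:R * m.+1%:R :> R.
  rewrite subr_sqr mulrC -natrD -natrB; last by lia.
  by congr (_%:R * _%:R); lia.
have m0 : (m + n.+1).+1%:R != 0 :> R by rewrite pnatr_eq0.
have f1 := natr_fact_neq0 (m + n.+1).
by move: (m + n.+1)%N m0 f1 => M m0 f1; field; rewrite nat1r m0 f1.
Qed.

Let fact_prod a n :
  ((a + n)`!)%:R = (a`!)%:R * \prod_(0 <= j < n) (a + j).+1%:R :> R.
Proof.
elim: n => [|n IH]; first by rewrite addn0 big_geq// mulr1.
by rewrite addnS factS natrM IH big_nat_recr//= mulrC -mulrA.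
Qed.

(** The ratio is a product of [n] factors [1 + n / (m + j + 1)]: their number is independent of [m],
    and each tends to [1]. *)
Let cvg_fact_ratio n :
  (fun m => (((m + n + n)`!)%:R * (m`!)%:R / ((m + n)`!)%:R ^+ 2) : R)
    @ \oo --> (1 : R).
Proof.
have -> : (fun m => (((m + n + n)`!)%:R * (m`!)%:R / ((m + n)`!)%:R ^+ 2) : R) =
    (fun m => \prod_(0 <= j < n) (1 + n%:R * ((m + j).+1%:R)^-1)).
  apply/funext => m; rewrite (fact_prod (m + n)).
  have -> : \prod_(0 <= j < n) (1 + n%:R * ((m + j).+1%:R)^-1) =
      (\prod_(0 <= j < n) (m + n + j).+1%:R) *
      (\prod_(0 <= j < n) (m + j).+1%:R)^-1 :> R.
    rewrite -prodfV -big_split/=; apply: eq_bigr => j _.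
    have j0 : (m + j).+1%:R != 0 :> R by rewrite pnatr_eq0.
    have -> : (m + n + j).+1 = (n + (m + j).+1)%N by lia.
    by rewrite natrD mulrDl divff// addrC.
  rewrite expr2 [in X in _ / (_ * X)]fact_prod.
  have f1 := natr_fact_neq0 m; have f2 := natr_fact_neq0 (m + n).
  have f3 : \prod_(0 <= j < n) (m + j).+1%:R != 0 :> R.
    by rewrite prodf_seq_neq0; apply/allP => j _; rewrite pnatr_eq0.
  by field; rewrite f1 f2 f3.
(* Only the number of factors is generalized; the [n] inside each factor stays fixed. *)
elim: {1}n => [|p IH].
  under eq_fun do rewrite big_geq//.
  exact: cvg_cst.
have hp : (fun m => ((m + p).+1%:R)^-1 : R) @ \oo --> (0 : R).
  by have := @cvg_harmonic R; rewrite -(cvg_shiftn p).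
have h : (fun m => 1 + n%:R * ((m + p).+1%:R)^-1 : R) @ \oo --> (1 : R).
  have := cvgD (cvg_cst (1 : R)) (cvgM (cvg_cst (n%:R : R)) hp).
  by rewrite mulr0 addr0; apply.
have := cvgM IH h; rewrite mulr1 => /(_ _) c; apply: cvg_trans c.
by apply: near_eq_cvg; apply: nearW => m /=; rewrite big_nat_recr.
Qed.

Let cvg_qprod n : (0 < n)%N ->
  (fun N => \prod_(1 <= k < N.+1) qfactor n k) @ \oo --> ((-1) ^+ n.-1 / 2 : R).
Proof.
move=> n0; rewrite -(cvg_shiftn n).
rewrite (eq_cvg _ _ (fun m => qprod_ge m n0)).
by have := cvgM (cvg_cst ((-1) ^+ n.-1 / 2 : R)) (@cvg_fact_ratio n);
  rewrite mulr1; apply.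
Qed.

Definition sqdev (lam : nat -> R[i]) (k : nat) : R[i] :=
  (lam k - k%:R ^+ 2) / k%:R.

(** The factor of index [n], equal to [sqdev lam n / n], is set apart; every other one is [qfactor n
    k * (1 + relfactor (sqdev lam) n k)], so that the limits multiply. *)
Lemma Delta_at_square (lam : nat -> R[i]) (n : nat) (l : R[i]) : (0 < n)%N ->
  (pprod (sqdev lam) n : nat -> R[i]^o) @ \oo --> (l : R[i]^o) ->
  n%:R * Delta lam (n%:R ^+ 2) =
  (pi * ((-1) ^+ n.-1 / 2))%:C * (sqdev lam n * l).
Proof.
move=> n0 hl.
have nz : n%:R != 0 :> R[i] by rewrite pnatr_eq0 -lt0n.
suff : (fun N => \prod_(1 <= k < N.+1) ((lam k - n%:R ^+ 2) / k%:R ^+ 2) : R[i]^o)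
    @ \oo --> (((-1) ^+ n.-1 / 2 : R)%:C * l * (sqdev lam n / n%:R) : R[i]^o).
  move=> /(cvg_lim (@norm_hausdorff _ _)) h; rewrite /Delta h rmorphM/=.
  by field.
have hq : (fun N => (\prod_(1 <= k < N.+1) qfactor n k)%:C : R[i]^o) @ \oo -->
    (((-1) ^+ n.-1 / 2 : R)%:C : R[i]^o).
  by apply: cvg_ReIm => /=; [exact: cvg_qprod|exact: cvg_cst].
apply: cvg_trans (cvgM (cvgM hq hl) (cvg_cst (sqdev lam n / n%:R : R[i]^o))).
apply: near_eq_cvg; near=> N.
have nN : (n <= N)%N by near: N; exists n.
(* The isolated factor becomes a product with one nontrivial term, present only once [n <= N]; the
   products can then be compared term by term. *)
have -> : sqdev lam n / n%:R =
    \prod_(1 <= k < N.+1) (if k == n then sqdev lam k / k%:R else 1) :> R[i].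
  by rewrite -big_mkcond big_nat1_eq n0 ltnS nN.
rewrite /= rmorph_prod /pprod -!big_split/=.
rewrite !big_nat; apply: eq_bigr => k /andP[k0 _].
have kz : k%:R != 0 :> R[i] by rewrite pnatr_eq0 -lt0n.
rewrite /qfactor /relfactor /sqdev; case: eqVneq => [->|kn].
  by rewrite subrr invr0 mulr0 addr0 !mul1r; field.
have knz : k%:R ^+ 2 - n%:R ^+ 2 != 0 :> R[i].
  by rewrite subr_eq0 -!natrX eqr_nat eqn_exp2r.
rewrite mulr1 fmorph_div rmorphB !rmorphXn !rmorph_nat.
by field; rewrite kz knz.
Unshelve. all: by end_near. Qed.

End DeltaAtSquares.

(** * Bessel's inequality for real sine polynomials *)

Section SineSystem.
Variable R : realType.
Local Notation mu := (@lebesgue_measure R).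

Let sin_natpi n : sin (n%:R * pi) = 0 :> R.
Proof.
elim: n => [|n IH]; first by rewrite mul0r sin0.
by rewrite -natr1 mulrDl mul1r sinD IH sinpi mul0r mulr0 addr0.
Qed.

(* The coefficient involving [k - m] vanishes at [k = m], where [0^-1 = 0]. *)
Let prim (k m : nat) (x : R) : R :=
  (k == m)%:R / 2 * x + (2 * (k%:R - m%:R))^-1 * sin ((k%:R - m%:R) * x)
  - (2 * (k%:R + m%:R))^-1 * sin ((k%:R + m%:R) * x).

Let is_derive_sinZ (c x : R) :
  is_derive x 1 (fun y : R => sin (c * y)) (cos (c * x) * c).
Proof.
have h : is_derive x 1 (fun y : R => c * y) c.
  have := is_deriveZ c (is_derive_id x (1 : R)).
  by rewrite /GRing.scale/= mulr1.
exact: (@is_derive1_comp _ sin (fun y => c * y) x _ _ (is_derive_sin (c * x)) h).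
Qed.

Let is_derive_prim k m (x : R) : (0 < k)%N ->
  is_derive x 1 (prim k m) (sin (k%:R * x) * sin (m%:R * x)).
Proof.
move=> k0; rewrite /prim.
have hid : is_derive x 1 (fun y : R => y) (1 : R) by exact: is_derive_id.
have h := is_deriveB (is_deriveD (is_deriveZ ((k == m)%:R / 2) hid)
   (is_deriveZ (2 * (k%:R - m%:R))^-1 (is_derive_sinZ (k%:R - m%:R) x)))
   (is_deriveZ (2 * (k%:R + m%:R))^-1 (is_derive_sinZ (k%:R + m%:R) x)).
apply: (is_derive_eq h); rewrite /GRing.scale/= mulr1.
have kmn : k%:R + m%:R != 0 :> R.
  by rewrite -natrD pnatr_eq0 addn_eq0 negb_and -lt0n k0.
rewrite [(k%:R + _) * x]mulrDl cosD mulrBl cosB.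
(* On the diagonal the linear term of [prim] supplies the constant [1/2] of [sin^2]. *)
case: (eqVneq k m) kmn => [->|km] kmn.
  rewrite !subrr !mulr0 mul1r.
  have := cos2Dsin2 (m%:R * x) => cs.
  have -> : cos (m%:R * x) * cos (m%:R * x) = 1 - sin (m%:R * x) ^+ 2.
    by apply/eqP; rewrite eq_sym subr_eq -expr2 cs.
  by field.
have kmn' : k%:R - m%:R != 0 :> R by rewrite subr_eq0 eqr_nat.
by rewrite mul0r; field; rewrite kmn kmn'.
Qed.

Let is_derive_bigsum (I : Type) (s : seq I) (f df : I -> R -> R) (x : R) :
  (forall i, is_derive x 1 (f i) (df i x)) ->
  is_derive x 1 (fun y => \sum_(i <- s) f i y) (\sum_(i <- s) df i x).
Proof.
move=> h; elim: s => [|i s IH].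
  rewrite big_nil; under eq_fun do rewrite big_nil.
  exact: is_derive_cst.
rewrite big_cons; under eq_fun do rewrite big_cons.
exact: is_deriveD.
Qed.

(** Orthogonality is read off an explicit antiderivative [F]: at [pi] only the diagonal linear terms
    survive, at [0] nothing. The inequality comes from enlarging the open interval to the closed
    one. *)
Lemma integral_sine_poly_sqr (a : nat -> R) (n : nat) :
  (\int[mu]_(x in `]0%R, pi[)
     ((\sum_(1 <= k < n.+1) a k * sin (k%:R * x)) ^+ 2)%:E
   <= (pi / 2 * \sum_(1 <= k < n.+1) a k ^+ 2)%:E)%E.
Proof.
pose f (x : R) := (\sum_(1 <= k < n.+1) a k * sin (k%:R * x)) ^+ 2.
pose F (x : R) := \sum_(0 <= k < n) \sum_(0 <= m < n)
  a k.+1 * a m.+1 * prim k.+1 m.+1 x.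
have dF (x : R) : is_derive x 1 F (f x).
  have -> : f x = \sum_(0 <= k < n) \sum_(0 <= m < n)
      a k.+1 * a m.+1 * (sin (k.+1%:R * x) * sin (m.+1%:R * x)).
    rewrite /f big_add1/= expr2 mulr_suml; apply: eq_bigr => k _.
    by rewrite mulr_sumr; apply: eq_bigr => m _; ring.
  apply: (@is_derive_bigsum _ _ _ (fun k x => \sum_(0 <= m < n)
      a k.+1 * a m.+1 * (sin (k.+1%:R * x) * sin (m.+1%:R * x)))) => k.
  apply: (@is_derive_bigsum _ _ _ (fun m x =>
      a k.+1 * a m.+1 * (sin (k.+1%:R * x) * sin (m.+1%:R * x)))) => m.
  exact: is_deriveZ (is_derive_prim m.+1 x _).
have cF (x : R) : {for x, continuous F}.
  by apply: differentiable_continuous; apply/derivable1_diffP.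
have cf : continuous f.
  move=> x.
  have dg : is_derive x 1 (fun y : R => \sum_(1 <= k < n.+1) a k * sin (k%:R * y))
      (\sum_(1 <= k < n.+1) a k * (cos (k%:R * x) * k%:R)).
    apply: (@is_derive_bigsum _ _ _
      (fun k x => a k * (cos (k%:R * x) * k%:R))) => k.
    exact: is_deriveZ (is_derive_sinZ k%:R x).
  have cg : {for x, continuous (fun y : R =>
      \sum_(1 <= k < n.+1) a k * sin (k%:R * y))}.
    by apply: differentiable_continuous; apply/derivable1_diffP.
  exact: (continuous_comp cg (@exprn_continuous R 2 _)).
have pi0 := pi_gt0 R.
apply: (@le_trans _ _ (\int[mu]_(x in `[0%R, pi]) (f x)%:E)%E).
  apply: ge0_subset_integral => //=.
  - apply/measurable_EFinP; apply: measurable_funTS.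
    exact: continuous_measurable_fun.
  - by move=> x _; rewrite lee_fin sqr_ge0.
  - exact: subset_itv_oo_cc.
rewrite (@continuous_FTC2 _ f F)//; last 3 first.
- exact: continuous_subspaceT.
- split.
  + by move=> x _; exact: ex_derive.
  + exact: cvg_at_right_filter (cF 0).
  + exact: cvg_at_left_filter (cF pi).
- by move=> x _; rewrite derive1E derive_val.
have -> : F 0 = 0.
  rewrite /F; apply: big1 => k _; apply: big1 => m _.
  by rewrite /prim !mulr0 sin0 !mulr0 subr0 addr0 mulr0.
have -> : F pi = pi / 2 * \sum_(1 <= k < n.+1) a k ^+ 2.
  rewrite /F big_add1 mulr_sumr/= !big_mkord; apply: eq_bigr => k _.
  rewrite big_mkord (bigD1 k)//= big1 => [|m mk].
    rewrite /prim eqxx subrr !mul0r sin0 mulr0 -natrD sin_natpi mulr0.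
    by rewrite subr0 !addr0 /= mulr1n; field.
  have km : (k.+1 == m.+1) = false by rewrite eqSS eq_sym val_eqE (negPf mk).
  rewrite /prim km !mul0r -natrD sin_natpi mulr0 subr0 add0r.
  by rewrite mulrBl sinB !sin_natpi mul0r mulr0 subrr !mulr0.
by rewrite sube0.
Qed.

End SineSystem.

(** * Squared L_2 norms on []0, pi[] *)

Section SquareIntegrals.
Variable R : realType.
Local Notation nc := (@Normc.normc R).
Local Notation mu := (@lebesgue_measure R).
Local Notation D := (`]0%R, (pi : R)[%classic).

Definition sqint (f : R -> R[i]) : \bar R :=
  (\int[mu]_(x in D) (nc (f x) ^+ 2)%:E)%E.

Definition meas0pi (f : R -> R[i]) : Prop :=
  measurable_fun D (fun x => complex.Re (f x)) /\
  measurable_fun D (fun x => complex.Im (f x)).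

Lemma Lnorm0pi2E (f : R -> R[i]) : Lnorm0pi 2%:E f = sqrte (sqint f).
Proof.
rewrite /Lnorm0pi unlock poweR12_sqrt; last first.
  by apply: integral_ge0 => x _; exact: poweR_ge0.
rewrite /sqint [in RHS]integral_mkcond; congr sqrte; apply: eq_integral => x _.
rewrite !patchE; case: ifPn => _; last by rewrite abse0 poweR_EFin powR0.
by rewrite gee0_abs ?lee_fin ?normc_ge0// poweR_EFin powR_mulrn ?normc_ge0.
Qed.

Lemma sqint_ge0 f : (0 <= sqint f)%E.
Proof. by apply: integral_ge0 => x _; rewrite lee_fin sqr_ge0. Qed.

Lemma meas0piD f g : meas0pi f -> meas0pi g -> meas0pi (fun x => f x + g x).
Proof.
move=> [fr fi] [gr gi]; split.
  rewrite (_ : (fun x => _) = (fun x => complex.Re (f x)) \+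
      (fun x => complex.Re (g x))); first exact: measurable_funD.
  by apply/funext => x; rewrite raddfD.
rewrite (_ : (fun x => _) = (fun x => complex.Im (f x)) \+
    (fun x => complex.Im (g x))); first exact: measurable_funD.
by apply/funext => x; rewrite raddfD.
Qed.

Lemma meas0piB f g : meas0pi f -> meas0pi g -> meas0pi (fun x => f x - g x).
Proof.
move=> [fr fi] [gr gi]; split.
  rewrite (_ : (fun x => _) = (fun x => complex.Re (f x)) \-
      (fun x => complex.Re (g x))); first exact: measurable_funB.
  by apply/funext => x; rewrite raddfB.
rewrite (_ : (fun x => _) = (fun x => complex.Im (f x)) \-
    (fun x => complex.Im (g x))); first exact: measurable_funB.
by apply/funext => x; rewrite raddfB.
Qed.

Lemma measurable_normc2 f : meas0pi f ->
  measurable_fun D (fun x => (nc (f x) ^+ 2)%:E).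
Proof.
move=> [fr fi]; apply/measurable_EFinP.
rewrite (_ : (fun x => _) =
    (fun x => complex.Re (f x) ^+ 2) \+ (fun x => complex.Im (f x) ^+ 2));
  last by apply/funext => x; rewrite /= normcX2.
by apply: measurable_funD; exact: measurable_funX.
Qed.

(** Pointwise [(a + b + c)^2 <= 3 (a^2 + b^2 + c^2)]. This replaces the triangle inequality of L_2,
    and the factor [3] only enlarges the final constant. *)
Lemma sqint_le3 f g h : meas0pi f -> meas0pi g -> meas0pi h ->
  (sqint (fun x => (f x + g x + h x)%R) <= 3%:E * (sqint f + sqint g + sqint h))%E.
Proof.
move=> mf mg mh.
have pos (u : R -> R[i]) x : D x -> (0 <= (nc (u x) ^+ 2)%:E)%E.
  by move=> _; rewrite lee_fin sqr_ge0.
have sm (u : R -> R[i]) : meas0pi u -> measurable_fun D (fun x => (nc (u x) ^+ 2)%:E).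
  exact: measurable_normc2.
rewrite /sqint -ge0_integralD//; last 4 first.
- exact: pos.
- exact: sm.
- exact: pos.
- exact: sm.
rewrite -ge0_integralD//; last 4 first.
- by move=> x Dx; rewrite adde_ge0// lee_fin sqr_ge0.
- by apply: emeasurable_funD; exact: sm.
- exact: pos.
- exact: sm.
rewrite -ge0_integralZl_EFin//; last 2 first.
- by move=> x Dx; rewrite !adde_ge0// lee_fin sqr_ge0.
- by do 2?apply: emeasurable_funD; exact: sm.
apply: ge0_le_integral => //.
- exact: pos.
- by apply: sm; apply: meas0piD => //; exact: meas0piD.
- by apply: measurable_funeM; do 2?apply: emeasurable_funD; exact: sm.
move=> x _; rewrite -!EFinD -EFinM lee_fin.
have h1 : nc (f x + g x + h x) <= nc (f x) + nc (g x) + nc (h x).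
  by apply: le_trans (normcD _ _) _; rewrite lerD2r normcD.
apply: (@le_trans _ _ ((nc (f x) + nc (g x) + nc (h x)) ^+ 2)).
  by rewrite ler_pXn2r ?nnegrE ?addr_ge0 ?normc_ge0.
have := sqr_ge0 (nc (f x) - nc (g x)); have := sqr_ge0 (nc (f x) - nc (h x)).
have := sqr_ge0 (nc (g x) - nc (h x)); nra.
Qed.

Lemma sqint_le_cst f (M : R) : meas0pi f -> 0 <= M ->
  (forall x, nc (f x) ^+ 2 <= M) -> (sqint f <= (M * pi)%:E)%E.
Proof.
move=> mf M0 h; rewrite EFinM.
have -> : (pi%:E = mu D :> \bar R)%E.
  by rewrite lebesgue_measure_itv/= lte_fin pi_gt0 sube0.
rewrite -integral_cst//; apply: ge0_le_integral => //.
- by move=> x _; rewrite lee_fin sqr_ge0.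
- exact: measurable_normc2.
- by move=> x _; rewrite lee_fin.
Qed.

Lemma sqint_small (f : nat -> R -> R[i]) :
  (fun n => Lnorm0pi 2%:E (f n)) @ \oo --> 0%E ->
  forall e : R, 0 < e -> \forall n \near \oo, (sqint (f n) <= e%:E)%E.
Proof.
move=> cf e e0.
have se0 : (0%E < (Num.sqrt e)%:E)%E by rewrite lte_fin sqrtr_gt0.
have h : \forall n \near \oo, (Lnorm0pi 2%:E (f n) < (Num.sqrt e)%:E)%E.
  exact: cf (open_ereal_lt' se0).
apply: filterS h => n.
rewrite Lnorm0pi2E => /ltW.
by rewrite -[(Num.sqrt e)%:E]/(sqrte e%:E) lee_sqrt// lee_fin ltW.
Qed.

Lemma ae0_of_sqint f : meas0pi f -> (sqint f <= 0)%E ->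
  {ae mu, forall x, D x -> f x = 0}.
Proof.
move=> mf f0.
have : (\int[mu]_(x in D) `|(nc (f x) ^+ 2)%:E| = 0)%E.
  apply/eqP; rewrite eq_le integral_ge0// andbT.
  by under eq_integral do rewrite gee0_abs ?lee_fin ?sqr_ge0//.
move=> h0; have := proj1 (ae_eq_integral_abs mu (measurable_itv _) (measurable_normc2 mf)) h0.
apply: filterS => x h Dx; have := h Dx => -[] /eqP.
by rewrite sqrf_eq0 => /eqP/Normc.eq0_normc.
Qed.

End SquareIntegrals.

(** * Complex sine polynomials and their uniform limits *)

Section SinePolynomials.
Variable R : realType.
Local Notation nc := (@Normc.normc R).
Local Notation mu := (@lebesgue_measure R).
Local Notation D := (`]0%R, (pi : R)[%classic).

Definition spoly (e : nat -> R[i]) (n : nat) (x : R) : R[i] :=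
  (2 / pi)%:C * \sum_(1 <= k < n.+1) e k * (sin (k%:R * x))%:C.

Lemma spolyB a b n x :
  spoly a n x - spoly b n x = spoly (fun k => a k - b k) n x.
Proof.
rewrite /spoly -mulrBr -sumrB; congr (_ * _).
by apply: eq_bigr => k _; rewrite mulrBl.
Qed.

Lemma continuous_sinZ (c : R) : continuous (fun y : R => sin (c * y)).
Proof.
move=> x; apply: (@continuous_comp _ _ _ (fun y : R => c * y) sin).
  exact: mulrl_continuous.
exact: continuous_sin.
Qed.

Lemma continuous_spoly e n : continuous (spoly e n : R -> R[i]^o).
Proof.
move=> x; suff c : (fun y => \sum_(1 <= k < n.+1) e k * (sin (k%:R * y))%:C : R[i]^o)
    @ x --> (\sum_(1 <= k < n.+1) e k * (sin (k%:R * x))%:C : R[i]^o).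
  by apply: cvgM c; exact: cvg_cst.
apply: cvg_big => [|k _]; first by move=> xy; apply: cvgD; [exact: cvg_fst|exact: cvg_snd].
apply: cvgM; first exact: cvg_cst.
apply: cvg_ReIm => /=; last exact: cvg_cst.
exact: continuous_sinZ.
Qed.

Lemma continuous_meas0pi (f : R -> R[i]) :
  continuous (f : R -> R[i]^o) -> meas0pi f.
Proof.
move=> cf; split; apply: measurable_funTS; apply: continuous_measurable_fun => x;
  apply/cvgrPdist_lt => e e0; near=> t.
- apply: (@le_lt_trans _ _ (nc (f x - f t))).
    by rewrite -raddfB; exact: normc_Re.
  by near: t; move/cvg_normcP: (cf x); apply.
- apply: (@le_lt_trans _ _ (nc (f x - f t))).
    by rewrite -raddfB; exact: normc_Im.
  by near: t; move/cvg_normcP: (cf x); apply.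
Unshelve. all: by end_near. Qed.

(** The sines being real, real and imaginary parts of the coefficients separate; the constant is
    [(2 / pi)^2 * (pi / 2)]. *)
Lemma sqint_spoly e n :
  (sqint (spoly e n) <= (2 / pi * \sum_(1 <= k < n.+1) nc (e k) ^+ 2)%:E)%E.
Proof.
have pi0 := pi_gt0 R; have piN0 : pi != 0 :> R by rewrite gt_eqF.
pose re k := complex.Re (e k); pose im k := complex.Im (e k).
pose S (a : nat -> R) x := \sum_(1 <= k < n.+1) a k * sin (k%:R * x).
have sE x : (nc (spoly e n x) ^+ 2)%:E =
    (((2 / pi) ^+ 2)%:E * ((S re x ^+ 2)%:E + (S im x ^+ 2)%:E))%E.
  rewrite -EFinD -EFinM /spoly Normc.normcM normc_real exprMn.
  rewrite real_normK ?num_real// normcX2 !raddf_sum/=.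
  by congr (_ * (_ ^+ 2 + _ ^+ 2))%:E; apply: eq_bigr => k _;
    rewrite /re /im; case: (e k) => a b /=; rewrite !mulr0 ?subr0 ?add0r ?addr0.
have mS a : measurable_fun D (fun x => (S a x ^+ 2)%:E).
  apply/measurable_EFinP; apply: measurable_funX.
  apply: measurable_sum => k; apply: measurable_funM; first exact: measurable_cst.
  apply: measurable_funTS; apply: continuous_measurable_fun.
  exact: continuous_sinZ.
rewrite /sqint; under eq_integral do rewrite sE.
rewrite ge0_integralZl_EFin//; last 3 first.
- by move=> x _; rewrite adde_ge0// lee_fin sqr_ge0.
- by apply: emeasurable_funD; exact: mS.
- exact: sqr_ge0.
rewrite ge0_integralD//; last 4 first.
- by move=> x _; rewrite lee_fin sqr_ge0.
- exact: mS.
- by move=> x _; rewrite lee_fin sqr_ge0.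
- exact: mS.
apply: (@le_trans _ _ (((2 / pi) ^+ 2)%:E *
    ((pi / 2 * \sum_(1 <= k < n.+1) re k ^+ 2)%:E +
     (pi / 2 * \sum_(1 <= k < n.+1) im k ^+ 2)%:E))%E).
  rewrite lee_wpmul2l ?lee_fin ?sqr_ge0//.
  by apply: leeD; exact: integral_sine_poly_sqr.
rewrite -EFinD -EFinM lee_fin -mulrDr -big_split/= mulrA.
have -> : (2 / pi) ^+ 2 * (pi / 2) = 2 / pi :> R.
  by move: (pi : R) piN0 => p p0; field.
by rewrite ler_wpM2l ?divr_ge0 ?pi_ge0// ler_sum// => k _; rewrite normcX2.
Qed.

(* The factor [2 / pi] in [spoly] is at most [1], so [L] itself is a bound. *)
Lemma spoly_limit e (L : R) : (forall N, \sum_(1 <= k < N.+1) nc (e k) <= L) ->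
  exists g : R -> R[i],
  [/\ continuous (g : R -> R[i]^o), forall x, nc (g x) <= L &
      forall d : R, 0 < d ->
        \forall n \near \oo, forall x, nc (spoly e n x - g x) <= d].
Proof.
move=> hL.
pose s n := \sum_(1 <= k < n.+1) nc (e k).
have s_nd : {homo s : m n / (m <= n)%N >-> m <= n}.
  move=> m n mn; rewrite /s [leRHS](@big_cat_nat _ _ _ m.+1)//= lerDl.
  by apply: sumr_ge0 => k _; exact: normc_ge0.
have cs : cvgn s.
  by apply: nondecreasing_is_cvgn => //; exists L => _ [n _ <-]; exact: hL.
have pi2 : 0 <= 2 / (pi : R) <= 1.
  apply/andP; split; first by rewrite divr_ge0// pi_ge0.
  by rewrite ler_pdivrMr ?pi_gt0// mul1r pi_ge2.
have step n x : nc (spoly e n.+1 x - spoly e n x) <= nc (e n.+1).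
  rewrite /spoly -mulrBr big_nat_recr//= addrAC subrr add0r.
  rewrite !Normc.normcM !normc_real -[leRHS]mul1r ler_pM ?mulr_ge0 ?normc_ge0//.
    by case/andP: pi2 => p0 p1; rewrite ger0_norm.
  by rewrite -[leRHS]mulr1 ler_wpM2l ?normc_ge0// ler_norml sin_geN1 sin_le1.
have dist x m n : (m <= n)%N -> nc (spoly e n x - spoly e m x) <= s n - s m.
  elim: n => [|n IH].
    by rewrite leqn0 => /eqP->; rewrite !subrr Normc.normc0.
  rewrite leq_eqVlt => /predU1P[->|mn]; first by rewrite !subrr Normc.normc0.
  rewrite -(subrK (spoly e n x) (spoly e n.+1 x)) -addrA.
  apply: le_trans (normcD _ _) _.
  have -> : s n.+1 - s m = nc (e n.+1) + (s n - s m).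
    by rewrite /s big_nat_recr//= addrAC addrC.
  by rewrite lerD// IH.
have [g hg] : {g : R -> R[i] & forall x,
    (spoly e ^~ x : nat -> R[i]^o) @ \oo --> (g x : R[i]^o)}.
  apply: (@choice R R[i] (fun x y => (spoly e ^~ x : nat -> R[i]^o) @ \oo -->
    (y : R[i]^o))) => x.
  apply: (@cvg_complex_bounded_variation _ _ L) => n.
  apply: le_trans (hL n); rewrite big_add1/=.
  by apply: ler_sum => k _; exact: step.
(* Letting [m] tend to infinity in [dist] gives a bound free of [x]: the convergence is uniform. *)
have tail x n : nc (spoly e n x - g x) <= limn s - s n.
  have c : (fun m => nc (spoly e m x - spoly e n x)) @ \oo -->
      nc (g x - spoly e n x).
    apply: cvg_normc; apply: (@cvgB _ R[i]^o); [exact: hg|exact: cvg_cst].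
  rewrite normc_distC -(cvg_lim (@Rhausdorff R) c); apply: limr_le.
    by apply/cvg_ex; eexists; exact: c.
  near=> m; apply: (@le_trans _ _ (s m - s n)).
    by apply: dist; near: m; exists n.
  by rewrite lerD2r; exact: nondecreasing_cvgn_le.
have unif d : 0 < d -> \forall n \near \oo, limn s - s n < d.
  move=> d0; have /cvgrPdist_lt/(_ _ d0) : s @ \oo --> limn s by [].
  by apply: filterS => n /(le_lt_trans (ler_norm _)).
exists g; split.
- move=> x; apply/cvg_normcP => d d0.
  have d3 : 0 < d / 3 by rewrite divr_gt0.
  have [n _ /(_ n (leqnn n)) hn] := unif _ d3.
  near=> y.
  have -> : g x - g y = (g x - spoly e n x) + (spoly e n x - spoly e n y) +
      (spoly e n y - g y) by ring.
  have -> : d = d / 3 + d / 3 + d / 3 by field.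
  apply: le_lt_trans (normcD _ _) _; apply: ltrD; last first.
    exact: le_lt_trans (tail _ _) hn.
  apply: le_lt_trans (normcD _ _) _; apply: ltrD.
    by rewrite normc_distC; exact: le_lt_trans (tail _ _) hn.
  by near: y; move/cvg_normcP: (@continuous_spoly e n x); apply.
(* At [n = 0] both the polynomial and [s] are [0], so [tail] bounds [g] itself by [limn s]. *)
- move=> x; have := tail x 0; rewrite /spoly /s !big_geq// mulr0 sub0r subr0.
  rewrite normc_opp => /le_trans; apply; apply: limr_le => //.
  by apply: nearW => n; exact: hL.
- move=> d /unif; apply: filterS => n hn x.
  exact: le_trans (tail x n) (ltW hn).
Unshelve. all: by end_near. Qed.

End SinePolynomials.

(** * From the sine coefficients to [w - wt] *)

Section Comparison.
Variable R : realType.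
Local Notation nc := (@Normc.normc R).
Local Notation mu := (@lebesgue_measure R).
Local Notation D := (`]0%R, (pi : R)[%classic).

Definition sine_coef (lam : nat -> R[i]) (k : nat) : R[i] :=
  k%:R * Delta lam (k%:R ^+ 2).

Lemma w_partialE (lam : nat -> R[i]) n : w_partial lam n = spoly (sine_coef lam) n.
Proof. by []. Qed.

Lemma meas0pi_w_partial (lam : nat -> R[i]) n : meas0pi (w_partial lam n).
Proof. exact: continuous_meas0pi (@continuous_spoly R (sine_coef lam) n). Qed.

(** Inserting the partial sums splits [w - wt - h] into three pieces, two of which vanish in the
    limit. With [h = 0] this yields the L_2 estimate; with [h] the continuous sum of the series and
    [B = 0] it identifies [w - wt] almost everywhere. *)
Lemma sqint_compare (lam lamt : nat -> R[i]) (w wt h : R -> R[i]) (B : R) :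
  associated_w lam w -> associated_w lamt wt -> meas0pi h ->
  (forall d : R, 0 < d -> \forall n \near \oo,
    (sqint (fun x => (w_partial lam n x - w_partial lamt n x - h x)%R)
      <= (B + d)%:E)%E) ->
  (sqint (fun x => (w x - wt x - h x)%R) <= (3 * B)%:E)%E.
Proof.
move=> [[wr wi _] cw] [[wtr wti _] cwt] mh hB.
have mw : meas0pi w by [].
have mwt : meas0pi wt by [].
apply/lee_addgt0Pr => e e0.
(* Three errors [e / 9], multiplied by the [3] of [sqint_le3], add up to [e]. *)
have d0 : 0 < e / 9 by rewrite divr_gt0.
have H1 := sqint_small cw d0; have H2 := sqint_small cwt d0.
have [n _ /(_ n (leqnn n)) /= [h1 [h2 h3]]] := filterI H1 (filterI H2 (hB _ d0)).
have {}h2 : (sqint (fun x => (w_partial lamt n x - wt x)%R) <= (e / 9)%:E)%E.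
  apply: le_trans h2; rewrite le_eqVlt; apply/orP; left; apply/eqP.
  by apply: eq_integral => x _; rewrite normc_distC.
have -> : (fun x => (w x - wt x - h x)%R) = (fun x =>
    (w x - w_partial lam n x) + (w_partial lamt n x - wt x) +
    (w_partial lam n x - w_partial lamt n x - h x))%R.
  by apply/funext => x; ring.
apply: le_trans (sqint_le3 _ _ _) _.
- exact: meas0piB (meas0pi_w_partial _ _).
- exact: meas0piB (meas0pi_w_partial _ _) _.
- apply: meas0piB => //.
  exact: meas0piB (meas0pi_w_partial _ _) (meas0pi_w_partial _ _).
apply: (@le_trans _ _ (3%:E * ((e / 9)%:E + (e / 9)%:E + (B + e / 9)%:E))%E).
  by rewrite lee_wpmul2l ?lee_fin//; do 2?apply: leeD.
by rewrite -!EFinD -EFinM lee_fin; lra.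
Qed.

Variables (lam lamt : nat -> R[i]) (r : R).
Hypothesis r0 : 0 <= r.
Hypothesis hb : forall N, \sum_(1 <= k < N.+1) nc (sqdev lam k) ^+ 2 <= r ^+ 2.
Hypothesis hbt :
  forall N, \sum_(1 <= k < N.+1) nc (sqdev lamt k) ^+ 2 <= r ^+ 2.

Let E := expR (2 * r).

Let T n N := nc (sqdev lam n * pprod (sqdev lam) n N -
                 sqdev lamt n * pprod (sqdev lamt) n N).

(** The sign [(-1) ^+ n.-1] is common to both coefficients and disappears under the modulus, leaving
    [pi / 2]. *)
Let cvg_coef_dist n : (0 < n)%N -> (fun N => pi / 2 * T n N) @ \oo -->
  nc (sine_coef lam n - sine_coef lamt n).
Proof.
move=> n0.
have [l hl] := cvg_pprod r0 hb n; have [lt hlt] := cvg_pprod r0 hbt n.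
rewrite /sine_coef (Delta_at_square n0 hl) (Delta_at_square n0 hlt).
rewrite -mulrBr Normc.normcM normc_real.
have -> : `|pi * ((-1) ^+ n.-1 / 2)| = pi / 2 :> R.
  rewrite !normrM normrX normrN1 expr1n mul1r ger0_norm ?pi_ge0//.
  by rewrite ger0_norm// invr_ge0.
apply: cvgM; first exact: cvg_cst.
apply: (@cvg_normc _ _ _ _ _ (sqdev lam n * l - sqdev lamt n * lt)).
exact: (cvgB (cvgM (cvg_cst (sqdev lam n : R[i]^o)) hl)
             (cvgM (cvg_cst (sqdev lamt n : R[i]^o)) hlt)).
Qed.

Lemma sum_sine_coef_dist_l1 (L : R) :
  (forall N, \sum_(1 <= k < N.+1) nc (sqdev lam k - sqdev lamt k) <= L) ->
  forall M, \sum_(1 <= k < M.+1) nc (sine_coef lam k - sine_coef lamt k) <=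
    pi / 2 * ((E + E ^+ 2 * (2 * r)) * L).
Proof.
move=> hL M.
(* The sum stays finite while [N] tends to infinity. The condition [0 < k] is repeated as a
   predicate so that [cvg_big] passes it on to [cvg_coef_dist]. *)
have c : (fun N => \sum_(1 <= k < M.+1 | (0 < k)%N) pi / 2 * T k N) @ \oo -->
    \sum_(1 <= k < M.+1 | (0 < k)%N) nc (sine_coef lam k - sine_coef lamt k).
  apply: cvg_big => [|k k0]; last exact: cvg_coef_dist.
  by move=> xy; apply: cvgD; [exact: cvg_fst|exact: cvg_snd].
have -> : \sum_(1 <= k < M.+1) nc (sine_coef lam k - sine_coef lamt k) =
    \sum_(1 <= k < M.+1 | (0 < k)%N) nc (sine_coef lam k - sine_coef lamt k).
  by rewrite big_nat_cond [RHS]big_nat_cond; apply: eq_bigl => k; lia.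
rewrite -(cvg_lim (@Rhausdorff R) c); apply: limr_le.
  by apply/cvg_ex; eexists; exact: c.
apply: nearW => N; rewrite -mulr_sumr ler_wpM2l ?divr_ge0 ?pi_ge0//.
apply: le_trans (sum_coef_dist_l1 r0 hb hbt hL M N).
rewrite [leRHS](bigID (fun k => (0 < k)%N))/=.
by rewrite lerDl sumr_ge0// => k _; exact: normc_ge0.
Qed.

Lemma sum_sine_coef_dist_l2 (L : R) :
  (forall N, \sum_(1 <= k < N.+1) nc (sqdev lam k - sqdev lamt k) ^+ 2 <= L) ->
  forall M, \sum_(1 <= k < M.+1) nc (sine_coef lam k - sine_coef lamt k) ^+ 2 <=
    (pi / 2) ^+ 2 * ((2 * E ^+ 2 + 8 * E ^+ 4 * r ^+ 2) * L).
Proof.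
move=> hL M.
have c : (fun N => \sum_(1 <= k < M.+1 | (0 < k)%N) (pi / 2 * T k N) ^+ 2) @ \oo -->
    \sum_(1 <= k < M.+1 | (0 < k)%N) nc (sine_coef lam k - sine_coef lamt k) ^+ 2.
  apply: cvg_big => [|k k0]; last by apply: cvgM; exact: cvg_coef_dist.
  by move=> xy; apply: cvgD; [exact: cvg_fst|exact: cvg_snd].
have -> : \sum_(1 <= k < M.+1) nc (sine_coef lam k - sine_coef lamt k) ^+ 2 =
    \sum_(1 <= k < M.+1 | (0 < k)%N) nc (sine_coef lam k - sine_coef lamt k) ^+ 2.
  by rewrite big_nat_cond [RHS]big_nat_cond; apply: eq_bigl => k; lia.
rewrite -(cvg_lim (@Rhausdorff R) c); apply: limr_le.
  by apply/cvg_ex; eexists; exact: c.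
apply: nearW => N; under eq_bigr do rewrite exprMn.
rewrite -mulr_sumr ler_wpM2l ?sqr_ge0//.
apply: le_trans (sum_coef_dist_l2 r0 hb hbt hL M N).
rewrite [leRHS](bigID (fun k => (0 < k)%N))/=.
by rewrite lerDl sumr_ge0// => k _; exact: sqr_ge0.
Qed.

Variables w wt : R -> R[i].
Hypothesis hw : associated_w lam w.
Hypothesis hwt : associated_w lamt wt.

Lemma L2_dist_le (L : R) :
  (forall N, \sum_(1 <= k < N.+1) nc (sqdev lam k - sqdev lamt k) ^+ 2 <= L) ->
  (sqint (fun x => (w x - wt x)%R) <=
    (3 * (2 / pi * ((pi / 2) ^+ 2 *
      ((2 * E ^+ 2 + 8 * E ^+ 4 * r ^+ 2) * L))))%:E)%E.
Proof.
move=> hL; have m0 : meas0pi (fun=> 0 : R[i]) by split; exact: measurable_cst.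
rewrite (_ : (fun x => _) = fun x => w x - wt x - 0); last first.
  by apply/funext => x; rewrite subr0.
apply: (sqint_compare hw hwt m0) => d d0; apply: nearW => n.
rewrite (_ : (fun x => _) =
  spoly (fun k => sine_coef lam k - sine_coef lamt k) n); last first.
  by apply/funext => x; rewrite subr0 !w_partialE spolyB.
apply: le_trans (sqint_spoly _ _) _; rewrite lee_fin.
rewrite -[leLHS]addr0 lerD ?(ltW d0)//.
rewrite ler_wpM2l ?divr_ge0 ?pi_ge0//; exact: sum_sine_coef_dist_l2.
Qed.

Lemma uniform_dist_le (L : R) :
  (forall N, \sum_(1 <= k < N.+1) nc (sqdev lam k - sqdev lamt k) <= L) ->
  exists g : R -> R[i],
  [/\ continuous (g : R -> R[i]^o),
      forall x, nc (g x) <= pi / 2 * ((E + E ^+ 2 * (2 * r)) * L) &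
      {ae mu, forall x, D x -> w x - wt x = g x}].
Proof.
move=> /sum_sine_coef_dist_l1/spoly_limit[g [cg gL gu]]; exists g; split=> //.
have mg := continuous_meas0pi cg.
have mwt : meas0pi wt by case: hwt => -[].
have mw : meas0pi w by case: hw => -[].
have h0 : (sqint (fun x => (w x - wt x - g x)%R) <= (3 * 0)%:E)%E.
  apply: (sqint_compare hw hwt mg) => d d0.
  (* A uniform error [sqrt (d / pi)] gives a squared integral of at most [d] over an interval of
     length [pi]. *)
  have e0 : 0 < Num.sqrt (d / pi) by rewrite sqrtr_gt0 divr_gt0// pi_gt0.
  apply: filterS (gu _ e0) => n hn.
  have -> : 0 + d = d / pi * pi :> R.
    by rewrite add0r divfK// gt_eqF// pi_gt0.
  apply: sqint_le_cst.
  - apply: meas0piB mg; apply: meas0piB; exact: meas0pi_w_partial.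
  - by rewrite divr_ge0 ?pi_ge0// ltW.
  - move=> x; rewrite !w_partialE spolyB.
    rewrite -[leRHS]sqr_sqrtr ?divr_ge0 ?pi_ge0 ?(ltW d0)//.
    by rewrite ler_pXn2r ?nnegrE ?normc_ge0 ?sqrtr_ge0.
rewrite mulr0 in h0.
have := ae0_of_sqint (meas0piB (meas0piB mw mwt) mg) h0.
apply: (@filterS _ _ (ae_filter_ringOfSetsType mu)) => x hx Dx.
by move: (hx Dx) => /eqP; rewrite subr_eq0 => /eqP.
Qed.

End Comparison.

(** * [Lambda] and [Lambda1] as distances of [sqdev] sequences *)

Section LambdaBounds.
Variable R : realType.
Local Notation nc := (@Normc.normc R).

Lemma partial_sum_le (u : nat -> R) (M : R) : (forall k, 0 <= u k) ->
  (\sum_(1 <= k <oo) (u k)%:E <= M%:E)%E ->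
  forall N, \sum_(1 <= k < N.+1) u k <= M.
Proof.
move=> u0 h N; rewrite -lee_fin -sumEFin; apply: le_trans h.
by apply: nneseries_lim_ge => k _ _; rewrite lee_fin.
Qed.

Lemma normc_sqdevB (lam lamt : nat -> R[i]) k :
  nc (sqdev lam k - sqdev lamt k) = nc (lam k - lamt k) / k%:R.
Proof.
by rewrite /sqdev -mulrBl opprD addrACA subrr addr0 Normc.normcM Normc.normcV
  normc_nat.
Qed.

Lemma Lambda_le_sum (lam lamt : nat -> R[i]) (r : R) : 0 <= r ->
  (Lambda lam lamt <= r%:E)%E ->
  forall N, \sum_(1 <= k < N.+1) nc (sqdev lam k - sqdev lamt k) ^+ 2 <= r ^+ 2.
Proof.
move=> r0 h; apply: partial_sum_le => [k|]; first exact: sqr_ge0.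
rewrite -lee_sqrt ?lee_fin ?sqr_ge0//=.
rewrite sqrtr_sqr ger0_norm//; apply: le_trans h.
rewrite /Lambda le_eqVlt; apply/orP; left; apply/eqP; congr sqrte.
by apply: eq_eseriesr => k _; rewrite normc_sqdevB expr_div_n.
Qed.

Lemma sqdev_square k : sqdev (fun n => n%:R ^+ 2) k = 0 :> R[i].
Proof. by rewrite /sqdev subrr mul0r. Qed.

(** Serves the continuity claim, where no bound on [Lambda] is given: each admissible sequence has a
    radius of its own. *)
Lemma l2_perturbed_squares_bound (lam : nat -> R[i]) :
  l2_perturbed_squares lam -> exists2 r : R, 0 <= r &
    forall N, \sum_(1 <= k < N.+1) nc (sqdev lam k) ^+ 2 <= r ^+ 2.
Proof.
move=> [kappa l2k lamE].
have : (0 <= \sum_(1 <= k <oo) (nc (kappa k) ^+ 2)%:E)%E.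
  by apply: nneseries_ge0 => k _ _; rewrite lee_fin sqr_ge0.
move: l2k; rewrite /l2.
case Ms : (\sum_(1 <= k <oo) _)%E => [M| |]// _; rewrite lee_fin => M0.
have hM : forall N, \sum_(1 <= k < N.+1) nc (kappa k) ^+ 2 <= M.
  by apply: partial_sum_le => [k|]; [exact: sqr_ge0|rewrite Ms].
(* From [sqdev = kappa (2 k + kappa) / k] and [|kappa| <= 1 + M] comes [|sqdev| <= (3 + M) |kappa|];
   [1 + M] stands in for the square root of [M]. *)
exists ((3 + M) * (1 + M)); first by rewrite mulr_ge0// addr_ge0.
have hk k : (0 < k)%N -> nc (kappa k) <= 1 + M.
  case: k => // k _; have : nc (kappa k.+1) ^+ 2 <= M.
    apply: le_trans (hM k.+1); rewrite big_nat_recr//= lerDr.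
    by apply: sumr_ge0 => *; exact: sqr_ge0.
  by have := normc_ge0 (kappa k.+1); nra.
have hs k : (0 < k)%N -> nc (sqdev lam k) <= (3 + M) * nc (kappa k).
  move=> k0; have k1 : 1 <= k%:R :> R by rewrite ler1n.
  have -> : sqdev lam k = kappa k * (2 * k%:R + kappa k) / k%:R.
    by rewrite /sqdev lamE//; congr (_ / _); ring.
  rewrite !Normc.normcM Normc.normcV normc_nat.
  rewrite ler_pdivrMr ?(lt_le_trans ltr01)//.
  have h1 : nc (2 * k%:R + kappa k) <= 2 * k%:R + (1 + M).
    apply: le_trans (normcD _ _) _; rewrite lerD ?hk//.
    by rewrite Normc.normcM !normc_nat.
  rewrite mulrC mulrAC ler_wpM2r ?normc_ge0//; apply: le_trans h1 _.
  by nra.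
move=> N; apply: (@le_trans _ _ ((3 + M) ^+ 2 * M)); last first.
  by rewrite exprMn ler_wpM2l ?sqr_ge0//; nra.
apply: (@le_trans _ _ ((3 + M) ^+ 2 * \sum_(1 <= k < N.+1) nc (kappa k) ^+ 2)).
  rewrite mulr_sumr !big_nat ler_sum// => k /andP[k0 _].
  by rewrite -exprMn ler_pXn2r ?nnegrE ?mulr_ge0 ?normc_ge0 ?addr_ge0 ?hs.
by rewrite ler_wpM2l ?sqr_ge0.
Qed.

End LambdaBounds.

Theorem lemma1 (R : realType) (r : R) (r_gt0 : 0 < r) :
  exists2 C : R, 0 < C &
    forall (lam lamt : nat -> R[i]),
      l2_perturbed_squares lam -> l2_perturbed_squares lamt ->
      forall (w wt : R -> R[i]), associated_w lam w -> associated_w lamt wt ->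
      ((Lambda lam (fun n : nat => (n%:R ^+ 2)%R) <= r%:E)%E ->
       (Lambda lamt (fun n : nat => (n%:R ^+ 2)%R) <= r%:E)%E ->
         (Lnorm0pi 2%:E (fun x => (w x - wt x)%R) <= C%:E * Lambda lam lamt)%E
         /\
         (Lnorm0pi +oo (fun x => (w x - wt x)%R) <= C%:E * Lambda1 lam lamt)%E)
      /\
      ((Lambda1 lam lamt < +oo)%E -> ae_continuous0pi (fun x => w x - wt x)).
Proof.
have r0 : 0 <= r := ltW r_gt0.
pose E := expR (2 * r).
have E0 : 0 < E := expR_gt0 _.
have pi0 := pi_gt0 R.
(* The [3] is from [sqint_compare], [2 / pi] from [sqint_spoly], [(pi / 2) ^+ 2] from
   [Delta_at_square], the last factor from [sum_coef_dist_l2]. *)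
pose C2 := 3 * (2 / pi * ((pi / 2) ^+ 2 * (2 * E ^+ 2 + 8 * E ^+ 4 * r ^+ 2))).
pose C1 := pi / 2 * (E + E ^+ 2 * (2 * r)).
have C20 : 0 < C2.
  apply: mulr_gt0 => //; apply: mulr_gt0; first exact: divr_gt0.
  apply: mulr_gt0; first by rewrite exprn_gt0// divr_gt0.
  by rewrite addr_gt0 ?mulr_gt0 ?exprn_gt0.
have C10 : 0 < C1.
  apply: mulr_gt0; first exact: divr_gt0.
  by rewrite addr_gt0 ?mulr_gt0 ?exprn_gt0.
(* The root appears because [C2] controls the squared norm; the sum lets one constant serve both
   estimates. *)
exists (Num.sqrt C2 + C1); first by rewrite addr_gt0// sqrtr_gt0.
move=> lam lamt lP ltP w wt hw hwt.
have L1le (L : R) : Lambda1 lam lamt = L%:E ->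
    forall N, \sum_(1 <= k < N.+1)
      Normc.normc (sqdev lam k - sqdev lamt k) <= L.
  move=> h; apply: partial_sum_le => [k|]; first exact: normc_ge0.
  rewrite -h /Lambda1 le_eqVlt; apply/orP; left; apply/eqP.
  by apply: eq_eseriesr => k _; rewrite normc_sqdevB.
have L1ge0 : (0 <= Lambda1 lam lamt)%E.
  apply: nneseries_ge0 => k _ _.
  by rewrite lee_fin mulr_ge0 ?normc_ge0 ?invr_ge0.
(* Continuity is proved first. Here [Lambda] is not bounded by [r], so the common radius [s + t] is
   taken from the two sequences. *)
split; last first.
  have [s s0 hs] := l2_perturbed_squares_bound lP.
  have [t t0 ht] := l2_perturbed_squares_bound ltP.
  case L1E : (Lambda1 lam lamt) L1ge0 => [L| |]// _ _.
  have st0 : 0 <= s + t by rewrite addr_ge0.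
  have hs' N : \sum_(1 <= k < N.+1) Normc.normc (sqdev lam k) ^+ 2 <= (s + t) ^+ 2.
    by apply: le_trans (hs N) _; rewrite ler_pXn2r ?nnegrE// lerDl.
  have ht' N : \sum_(1 <= k < N.+1) Normc.normc (sqdev lamt k) ^+ 2 <= (s + t) ^+ 2.
    by apply: le_trans (ht N) _; rewrite ler_pXn2r ?nnegrE// lerDr.
  have [g [cg _ wg]] := uniform_dist_le st0 hs' ht' hw hwt (L1le _ L1E).
  exists g; split; first exact: continuous_subspaceT.
  by apply: (@filterS _ _ (ae_filter_ringOfSetsType _)) wg => x h; rewrite inE => /h.
move=> /(Lambda_le_sum r0) hl /(Lambda_le_sum r0) hlt.
have hb N : \sum_(1 <= k < N.+1) Normc.normc (sqdev lam k) ^+ 2 <= r ^+ 2.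
  apply: le_trans (hl N); apply: ler_sum => k _.
  by rewrite sqdev_square subr0.
have hbt N : \sum_(1 <= k < N.+1) Normc.normc (sqdev lamt k) ^+ 2 <= r ^+ 2.
  apply: le_trans (hlt N); apply: ler_sum => k _.
  by rewrite sqdev_square subr0.
split.
  have L0 : (0 <= Lambda lam lamt)%E by exact: sqrte_ge0.
  have C0 : 0 < Num.sqrt C2 + C1 by rewrite addr_gt0// sqrtr_gt0.
  (* An infinite distance leaves nothing to prove: a positive constant times [+oo] is [+oo]. *)
  case LE : (Lambda lam lamt) L0 => [L| |]//; last first.
    by rewrite gt0_muley ?lte_fin ?leey.
  rewrite lee_fin => L0.
  have hL : forall N, \sum_(1 <= k < N.+1)
      Normc.normc (sqdev lam k - sqdev lamt k) ^+ 2 <= L ^+ 2.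
    by apply: (Lambda_le_sum L0); rewrite LE.
  have h : (sqint (fun x => (w x - wt x)%R) <= (C2 * L ^+ 2)%:E)%E.
    by have := L2_dist_le r0 hb hbt hw hwt hL; rewrite /C2 !mulrA.
  rewrite Lnorm0pi2E; apply: (@le_trans _ _ (sqrte (C2 * L ^+ 2)%:E)).
    by rewrite lee_sqrt// lee_fin mulr_ge0 ?sqr_ge0// (ltW C20).
  rewrite /= sqrtrM ?(ltW C20)// sqrtr_sqr ger0_norm// -EFinM lee_fin.
  by rewrite ler_wpM2r// lerDl (ltW C10).
case L1E : (Lambda1 lam lamt) L1ge0 => [L| |]//; last first.
  by rewrite gt0_muley ?leey// lte_fin addr_gt0// sqrtr_gt0.
rewrite lee_fin => L0.
have [g [_ gL wg]] := uniform_dist_le r0 hb hbt hw hwt (L1le _ L1E).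
rewrite /Lnorm0pi unlock; case: ifPn => _; last first.
  by rewrite mule_ge0 ?lee_fin// addr_ge0 ?sqrtr_ge0// ltW.
apply/ess_sup_inf.ess_supP; apply: (@filterS _ _ (ae_filter_ringOfSetsType _)) wg => x h.
rewrite /= patchE; case: ifPn => [|_]; last first.
  by rewrite abse0 mule_ge0 ?lee_fin// addr_ge0 ?sqrtr_ge0// ltW.
rewrite inE => /h ->; rewrite gee0_abs ?lee_fin ?normc_ge0//.
apply: le_trans (gL x) _.
by rewrite mulrA ler_wpM2r// lerDr sqrtr_ge0.
Qed.
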